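(* Let $\mathbb T$ be an arbitrary parameter set and let $X=\{X(t),t\in\mathbb T\}$ be a centered Gaussian process such that $m(\mathbb T):=\sup_{t\in\mathbb T}\left(\mathbb E|X(t)|^2\right)^{1/2}<\infty$, the pseudometric space $(\mathbb T,\rho_X)$ is separable, and $X$ is separable on $(\mathbb T,\rho_X)$, where $\rho_X(t,s)=\left(\mathbb E(X(t)-X(s))^2\right)^{1/2}$. Let $r:[1,\infty)\to[0,\infty)$ be nondecreasing and such that $y\mapsto r(e^y)$, $y\ge0$, is convex. Put $I_r(x)=\int_0^x r(N(v))\,dv$ for $x>0$, and assume $I_r(m(\mathbb T))<\infty$. Then: (i) for any $\theta\in(0,1)$ and any $\lambda>0$, \[ \mathbb E\exp\Big\{\lambda\sup_{t\in\mathbb T}|X(t)|\Big\}\le 2\exp\Big\{\frac{\lambda^2m^2(\mathbb T)}{2(1-\theta)^2}\Big\}\, r^{(-1)}\Big(\frac{I_r(\theta m(\mathbb T))}{\theta m(\mathbb T)}\Big); \] (ii) for any $\theta\in(0,1)$ and any $\mu>0$, \[ \mathbb P\Big\{\sup_{t\in\mathbb T}|X(t)|\ge\mu\Big\}\le 2\exp\Big\{-\frac{\mu^2(1-\theta)^2}{2m^2(\mathbb T)}\Big\}\, r^{(-1)}\Big(\frac{I_r(\theta m(\mathbb T))}{\theta m(\mathbb T)}\Big). \]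
   Context: $N(u)$, $u>0$, denotes the metric massiveness of $(\mathbb T,\rho_X)$: the number of open balls in a minimal $u$-covering of $(\mathbb T,\rho_X)$. For the function $r$, $r^{(-1)}(t)=\sup\{u\ge0: r(u)\le t\}$ is its generalized inverse. *)

(* Defs.v *)
From HB Require Import structures.
From mathcomp Require Import all_boot all_order all_algebra.
From mathcomp Require Import all_classical all_reals all_analysis.
From mathcomp Require Import measurable_realfun normal_distribution.
Set Implicit Arguments. Unset Strict Implicit. Unset Printing Implicit Defensive.
Import Order.TTheory GRing.Theory Num.Theory.
Import numFieldNormedType.Exports.
Local Open Scope classical_set_scope.
Local Open Scope ring_scope.

Section defs.
Context {R : realType} {d : measure_display} {Omega : measurableType d}.
Variable (P : probability Omega R).

(* Y is a centered Gaussian random variable (degenerate variance 0 allowed):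
   its distribution is either the Dirac mass at 0 or N(0, s^2) with s > 0. *)
Definition centered_gaussian_rv (Y : Omega -> R) : Prop :=
  measurable_fun setT Y /\
  ((forall A : set R, measurable A -> P (Y @^-1` A) = \d_(0:R) A) \/
   exists s : R, 0 < s /\
     forall A : set R, measurable A -> P (Y @^-1` A) = normal_prob 0 s A).

Definition centered_gaussian_process {T : Type} (X : T -> Omega -> R) : Prop :=
  forall (n : nat) (t : 'I_n -> T) (a : 'I_n -> R),
    centered_gaussian_rv (fun w => \sum_(i < n) a i * X (t i) w).

Definition rhoX {T : Type} (X : T -> Omega -> R) (t s : T) : R :=
  Num.sqrt (fine (\int[P]_w (((X t w - X s w) ^+ 2)%:E))%E).

Definition msup {T : Type} (X : T -> Omega -> R) : \bar R :=
  ereal_sup [set ((Num.sqrt (fine (\int[P]_w (((X t w) ^+ 2)%:E))%E))%:E)%E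
            | t in [set: T]].
End defs.

Definition dense_in {R : realType} {T : Type} (rho : T -> T -> R) (S : set T) :=
  forall t : T, forall e : R, 0 < e -> exists2 s, S s & rho t s < e.

Definition separable_pm {R : realType} {T : Type} (rho : T -> T -> R) :=
  exists S : set T, countable S /\ dense_in rho S.

Definition rho_open {R : realType} {T : Type} (rho : T -> T -> R) (U : set T) :=
  forall t, U t -> exists2 e : R, 0 < e & forall s, rho t s < e -> U s.

Definition separable_process {R : realType} {d : measure_display}
  {Omega : measurableType d} (P : probability Omega R) {T : Type}
  (rho : T -> T -> R) (X : T -> Omega -> R) :=
  exists S : set T, countable S /\ dense_in rho S /\
  exists Omega0 : set Omega, measurable Omega0 /\ P Omega0 = 0%E /\
    forall (U : set T) (D : set R), rho_open rho U -> closed D ->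
      let A1 := [set w | forall t, U t -> D (X t w)] in
      let A2 := [set w | forall t, U t -> S t -> D (X t w)] in
      (A1 `\` A2) `|` (A2 `\` A1) `<=` Omega0.

(* Metric massiveness N(u): number of open balls in a minimal u-covering of
   (T, rho); +oo if no finite covering exists. *)
Definition massiveness {R : realType} {T : Type} (rho : T -> T -> R) (u : R)
  : \bar R :=
  ereal_inf [set (n%:R)%:E | n in [set n : nat | exists c : nat -> T,
      forall t : T, exists2 i, (i < n)%N & rho (c i) t < u]].

Definition rN {R : realType} {T : Type} (r : R -> R) (rho : T -> T -> R) (v : R)
  : \bar R :=
  match massiveness rho v with
  | EFin x => (r x)%:E
  | _ => +oo%E
  end.

Definition Ir {R : realType} {T : Type} (r : R -> R) (rho : T -> T -> R) (x : R)
  : \bar R :=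
  (\int[lebesgue_measure]_(v in [set v : R | (0 < v)%R && (v <= x)%R]) rN r rho v)%E.

(* generalized inverse r^(-1)(t) = sup {u : r(u) <= t}, u ranging over the
   domain [1, oo) of r *)
Definition rinv {R : realType} (r : R -> R) (t : \bar R) : \bar R :=
  ereal_sup [set u%:E | u in [set u : R | 1 <= u /\ ((r u)%:E <= t)%E]].

(* Main.v *)
(* Chaining. With levels q^k m, a point s of a finite set is joined to coarser and coarser
   minimal nets, X s being the sum of the links of the chain; the k-th link has standard
   deviation at most q^k m and takes N (q^(k+1) m) values. Giving the k-th link the weight
   (1 - q) q^k and the remainder the weight q^K, Jensen's inequality for exp (in place of
   Hoelder's inequality) bounds E exp (l max |X|) by 2 exp (l^2 m^2 / (2 (1 - q)^2)) times the
   weighted geometric mean of the covering numbers, up to a factor J^(q^K) for a set of J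
   points, which disappears as K grows. By convexity of r o exp, r of that geometric mean is
   at most a lower sum for the entropy integral over ]0, q m] divided by q m, so the mean
   itself is at most r^(-1) of that quotient. Monotone convergence and separability pass to
   the whole index set, and the tail bound is Chernoff's. *)
Require Import Defs.
From HB Require Import structures.
From mathcomp Require Import all_boot all_order all_algebra.
From mathcomp Require Import all_classical all_reals all_analysis.
From mathcomp Require Import measurable_realfun normal_distribution.
From mathcomp Require Import ring lra.
Set Implicit Arguments.
Unset Strict Implicit.
Unset Printing Implicit Defensive.
Import Order.TTheory GRing.Theory Num.Theory.
Import numFieldNormedType.Exports.
Import HBNNSimple.
Local Open Scope classical_set_scope.
Local Open Scope ring_scope.

(** * Gaussian exponential moments *)

(** The hypothesis on [nu] settles indicators, linearity settles simple functions, and monotone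
    convergence along [nnsfun_approx] settles [f]. *)
Lemma ge0_integral_density (d : measure_display) (T : measurableType d)
  (R : realType) (mu nu : {measure set T -> \bar R}) (p : T -> R)
  (f : T -> \bar R) :
  measurable_fun setT p -> (forall x, 0 <= p x) ->
  (forall A, measurable A -> nu A = \int[mu]_(x in A) (p x)%:E)%E ->
  measurable_fun setT f -> (forall x, 0 <= f x)%E ->
  (\int[nu]_x f x = \int[mu]_x (f x * (p x)%:E))%E.
Proof.
move=> mp p0 nuE mf f0.
pose f_ := nnsfun_approx measurableT mf.
have mpE : measurable_fun setT (EFin \o p) by exact/measurable_EFinP.
have mf_ n : measurable_fun setT (fun x => (f_ n x)%:E).
  exact/measurable_EFinP.
have lim_f x : ((f_ n x)%:E @[n --> \oo] --> f x)%E.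
  by apply: cvg_nnsfun_approx.
transitivity (lim (\int[nu]_x (f_ n x)%:E @[n --> \oo])%E).
  rewrite -monotone_convergence//=.
  - by apply: eq_integral => x _; apply/esym/cvg_lim.
  - by move=> n x _; rewrite lee_fin.
  - by move=> x _ a b ab; rewrite lee_fin; exact/lefP/nd_nnsfun_approx.
transitivity (lim (\int[mu]_x ((f_ n x)%:E * (p x)%:E) @[n --> \oo])%E); last first.
  rewrite -monotone_convergence//=.
  - apply: eq_integral => x _; apply/cvg_lim => //.
    by apply: cvgeZr => //.
  - by move=> n; apply: emeasurable_funM.
  - by move=> n x _; rewrite mule_ge0 ?lee_fin.
  - move=> x _ a b ab; rewrite lee_wpmul2r ?lee_fin//.
    exact/lefP/nd_nnsfun_approx.
apply: congr_lim; apply/funext => n.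
under eq_integral do rewrite fimfunE -fsumEFin//.
rewrite ge0_integral_fsum//; last 2 first.
  - by move=> y; exact/measurable_EFinP/measurableT_comp.
  - by move=> y x _; rewrite EFinM nnfun_muleindic_ge0.
under [RHS]eq_integral.
  move=> x xD; rewrite fimfunE -fsumEFin// ge0_mule_fsuml; last first.
    by move=> y; rewrite EFinM nnfun_muleindic_ge0.
  over.
rewrite [RHS]ge0_integral_fsum//; last 2 first.
  - move=> y; apply: emeasurable_funM => //.
    exact/measurable_EFinP/measurableT_comp.
  - move=> y x _; rewrite mule_ge0//; last by rewrite lee_fin.
    by rewrite EFinM nnfun_muleindic_ge0.
apply: eq_fsbigr => y _.
(* A negative [y] has an empty level set; otherwise its sign allows pulling it out of the
   integral. *)
have [yneg|y0] := ltP y 0.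
  have -> : f_ n @^-1` [set y] = set0.
    by apply/seteqP; split => // x /= fy; move: yneg; rewrite -fy ltNge fun_ge0.
  rewrite [LHS]integral0_eq; last by move=> x _; rewrite indic0 mulr0.
  by rewrite [RHS]integral0_eq// => x _; rewrite indic0 mulr0 mul0e.
have mI : measurable (f_ n @^-1` [set y]) by [].
under eq_integral do rewrite EFinM.
rewrite ge0_integralZl//; last exact/measurable_EFinP.
rewrite integral_indic// setIT nuE//.
under [RHS]eq_integral do rewrite EFinM -muleA.
rewrite ge0_integralZl//; last 2 first.
  - by apply: emeasurable_funM => //; exact/measurable_EFinP.
  - by move=> x _; rewrite mule_ge0 ?lee_fin.
congr (_ * _)%E; rewrite integral_mkcond; apply: eq_integral => x _.
by rewrite patchE indicE; case: ifPn => _; rewrite ?mul1e ?mul0e.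
Qed.

Lemma ge0_integral_normal_prob (R : realType) (s : R) (f : R -> R) :
  measurable_fun setT f -> (forall x, 0 <= f x) ->
  (\int[normal_prob 0 s]_x (f x)%:E =
   \int[lebesgue_measure]_x (f x * normal_pdf 0 s x)%:E)%E.
Proof.
move=> mf f0.
rewrite (@ge0_integral_density _ _ _ lebesgue_measure _ (normal_pdf 0 s))//.
- exact: measurable_normal_pdf.
- exact: normal_pdf_ge0.
- exact/measurable_EFinP.
Qed.

(** Target of the next two computations, which rewrite their integrand as a constant times another
    normal density. *)
Lemma integral_scaled_normal_pdf (R : realType) (c m s : R) : 0 <= c ->
  (\int[lebesgue_measure]_x (c * normal_pdf m s x)%:E = c%:E)%E.
Proof.
move=> c0; under eq_integral do rewrite EFinM.
rewrite ge0_integralZl ?integral_normal_pdf ?mule1 ?lee_fin//.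
- by apply/measurable_EFinP; exact: measurable_normal_pdf.
- by move=> x _; rewrite lee_fin normal_pdf_ge0.
Qed.

(** Completing the square turns the integrand into a multiple of the density with mean
    [a * s ^+ 2]. *)
Lemma normal_mgf (R : realType) (s a : R) : 0 < s ->
  (\int[normal_prob 0 s]_x (expR (a * x))%:E = (expR (a ^+ 2 * s ^+ 2 / 2))%:E)%E.
Proof.
move=> s0; rewrite ge0_integral_normal_prob; last 2 first.
- by apply: measurableT_comp => //; exact: measurable_funM.
- by move=> x; exact: expR_ge0.
rewrite -(@integral_scaled_normal_pdf _ _ (a * s ^+ 2) s) ?expR_ge0//.
apply: eq_integral => x _; congr EFin.
rewrite !normal_pdfE ?gt_eqF// !(mulrCA _ (normal_peak s)).
congr (_ * _); rewrite /normal_fun -!expRD; congr expR.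
by field; rewrite gt_eqF.
Qed.

(** The coefficient of [x ^+ 2] is the one for which the integrand becomes [q] times the centered
    density of deviation [q * s]. *)
Lemma normal_expR_sqr (R : realType) (s q : R) : 0 < s -> 0 < q ->
  (\int[normal_prob 0 s]_x
     (expR (- ((q ^- 2 - 1) / (2 * s ^+ 2) * x ^+ 2)))%:E = q%:E)%E.
Proof.
move=> s0 q0; rewrite ge0_integral_normal_prob; last 2 first.
- apply: measurableT_comp => //; apply: measurableT_comp => //.
  by apply: measurable_funM => //; exact: measurable_funX.
- by move=> x; exact: expR_ge0.
rewrite -[RHS](@integral_scaled_normal_pdf _ _ 0 (q * s)) ?ltW//.
apply: eq_integral => x _; congr EFin.
have peakE : normal_peak s = q * normal_peak (q * s).
  rewrite /normal_peak.
  have -> : (q * s) ^+ 2 * pi *+ 2 = q ^+ 2 * (s ^+ 2 * pi *+ 2) by ring.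
  rewrite sqrtrM ?sqr_ge0//.
  by rewrite sqrtr_sqr gtr0_norm// invfM mulVKf// gt_eqF.
rewrite !normal_pdfE ?gt_eqF ?mulr_gt0// peakE.
rewrite -[q * normal_peak _ * _]mulrA !(mulrCA (expR _)); do 2 congr (_ * _).
rewrite /normal_fun -!expRD; congr expR.
by field; rewrite !gt_eqF.
Qed.

(** Makes the Gaussian second moment finite. For x >= 0, square 1 + x/2 <= exp (x/2). *)
Lemma sqr_le_expR (R : realType) (x : R) : x ^+ 2 <= 4 * (expR x + expR (- x)).
Proof.
wlog x0 : x / 0 <= x.
  move=> H; have [|/ltW x0] := leP 0 x; first exact: H.
  by have := H (- x); rewrite oppr_ge0 sqrrN opprK [expR (- x) + _]addrC; exact.
have h : 1 + x / 2 <= expR (x / 2) by exact: expR_ge1Dx.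
have -> : expR x = expR (x / 2) ^+ 2.
  by rewrite expr2 -expRD; congr expR; field.
have := expR_ge0 (- x); nra.
Qed.

(** Lets a bound on the standard deviation control the parameter [s]. Finiteness matters because
    [fine] sends [+oo] to 0. *)
Lemma normal_second_moment (R : realType) (s : R) : 0 < s ->
  exists2 v : R, (\int[normal_prob 0 s]_x (x ^+ 2)%:E = v%:E)%E & s ^+ 2 <= v.
Proof.
move=> s0.
have mexp (a : R) : measurable_fun setT (fun x : R => expR (a * x)).
  by apply: measurableT_comp => //; exact: measurable_funM.
have msq : measurable_fun setT (fun x : R => x ^+ 2) by exact: measurable_funX.
have fin : (\int[normal_prob 0 s]_x (x ^+ 2)%:E < +oo)%E.
  apply: (@le_lt_trans _ _ (\int[normal_prob 0%R s]_x
      (4%:E * ((expR (1 * x))%:E + (expR (-1 * x))%:E)))%E).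
    apply: ge0_le_integral => //.
    - by move=> x _; rewrite lee_fin sqr_ge0.
    - exact/measurable_EFinP.
    - by apply: measurable_funeM; apply: emeasurable_funD;
        apply/measurable_EFinP; exact: mexp.
    - by move=> x _; rewrite lee_fin mul1r mulN1r sqr_le_expR.
  rewrite ge0_integralZl//; last 2 first.
  - by apply: emeasurable_funD; apply/measurable_EFinP; exact: mexp.
  - by move=> x _; rewrite adde_ge0 ?lee_fin ?expR_ge0.
  rewrite ge0_integralD//; last 2 first.
  - by apply/measurable_EFinP; exact: mexp.
  - by apply/measurable_EFinP; exact: mexp.
  by rewrite !normal_mgf// -EFinD -EFinM ltry.
have ge0 : (0 <= \int[normal_prob 0 s]_x (x ^+ 2)%:E)%E.
  by apply: integral_ge0 => x _; rewrite lee_fin sqr_ge0.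
move: fin ge0; case I : (\int[_]_x _)%E => [v| |]// _; rewrite lee_fin => v0.
exists v => //.
(* [1 <= exp (- h x^2) + h x^2], where [h] makes the first term have mean [q]; then [q] is
   taken close to 1. *)
have key q : 0 < q -> q < 1 -> 1 <= q + (q ^- 2 - 1) / (2 * s ^+ 2) * v.
  move=> q0 q1; set h := (q ^- 2 - 1) / (2 * s ^+ 2).
  have h0 : 0 <= h.
    apply: divr_ge0; last by rewrite mulr_ge0// sqr_ge0.
    by rewrite subr_ge0 invf_ge1 ?exprn_gt0// exprn_ile1// ltW.
  rewrite -lee_fin EFinD EFinM -I -(@normal_expR_sqr _ s q)//.
  rewrite -ge0_integralZl//; last 2 first.
  - exact/measurable_EFinP.
  - by move=> x _; rewrite lee_fin sqr_ge0.
  rewrite -ge0_integralD//; last 3 first.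
  - apply/measurable_EFinP; apply: measurableT_comp => //.
    by apply: measurableT_comp => //; exact: measurable_funM.
  - by move=> x _; rewrite mule_ge0 ?lee_fin ?sqr_ge0.
  - by apply: measurable_funeM; exact/measurable_EFinP.
  have -> : (1%:E = \int[normal_prob 0%R s]_x (cst 1%E x))%E.
    by rewrite integral_cst//= probability_setT mule1.
  apply: ge0_le_integral => //.
  - apply: emeasurable_funD; last by apply: measurable_funeM; exact/measurable_EFinP.
    apply/measurable_EFinP; apply: measurableT_comp => //.
    by apply: measurableT_comp => //; exact: measurable_funM.
  - move=> x _; rewrite /cst -EFinM -EFinD lee_fin -/h.
    by have := expR_ge1Dx (- (h * x ^+ 2)); lra.
rewrite leNgt; apply/negP => vs.
have s20 : 0 < s ^+ 2 by rewrite exprn_gt0.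
(* Divided by 1 - q, [key] reads 2 s^2 q^2 <= (1 + q) v, which tends to s^2 <= v as q tends to 1.
   Since v = (1 - 4 del) s^2, it already fails at q = 1 - del. *)
pose del := (s ^+ 2 - v) / (4 * s ^+ 2).
have del0 : 0 < del by rewrite divr_gt0 ?subr_gt0// mulr_gt0.
have delE : 4 * s ^+ 2 * del = s ^+ 2 - v by rewrite /del; field; rewrite gt_eqF.
have del1 : del < 1 by nra.
have q0 : 0 < 1 - del by lra.
have q1 : 1 - del < 1 by lra.
have := key _ q0 q1; set q := 1 - del in q0 q1 *.
have -> : q + (q ^- 2 - 1) / (2 * s ^+ 2) * v =
   q + (1 - q ) * (1 + q) * v / (2 * s ^+ 2 * q ^+ 2).
  by field; rewrite !gt_eqF.
rewrite -lerBlDl -mulrA -[leLHS]mulr1 -mulrA ler_pM2l ?subr_gt0//.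
rewrite mulrA ler_pdivlMr ?mulr_gt0 ?exprn_gt0// mul1r /q.
nra.
Qed.

(* [measurableTypeR R] is [R] with the instance that carries [normal_prob]; the two are only
   convertible, so unification needs the type to be given. *)
Lemma centered_gaussian_integral (d : measure_display)
  (Omega : measurableType d) (R : realType) (P : probability Omega R)
  (Y : Omega -> measurableTypeR R)
  (nu : {measure set (measurableTypeR R) -> \bar R}) (f : measurableTypeR R -> R) :
  measurable_fun setT Y ->
  (forall A : set (measurableTypeR R), measurable A -> P (Y @^-1` A) = nu A) ->
  measurable_fun setT f -> (forall x, 0 <= f x) ->
  (\int[P]_w (f (Y w))%:E = \int[nu]_x (f x)%:E)%E.
Proof.
move=> mY PY mf f0.
have mfE : measurable_fun setT (EFin \o f) by exact/measurable_EFinP.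
have fE0 : {in setT, forall y, (0 <= (EFin \o f) y)%E}.
  by move=> y _; rewrite lee_fin.
have := ge0_integral_pushforward mY P measurableT mfE fE0.
rewrite preimage_setT => <-.
by apply: eq_measure_integral => A mA _; exact: PY.
Qed.

(** The factor 2 comes from exp (a|Y|) <= exp (aY) + exp (-aY). Each term has mean at most exp (a^2
    s^2 / 2), since the normal parameter is at most the standard deviation, hence at most [s]. *)
Lemma centered_gaussian_expR_norm (d : measure_display)
  (Omega : measurableType d) (R : realType) (P : probability Omega R)
  (Y : Omega -> R) (s a : R) :
  centered_gaussian_rv P Y ->
  Num.sqrt (fine (\int[P]_w ((Y w) ^+ 2)%:E)%E) <= s ->
  (\int[P]_w (expR (a * `|Y w|))%:E <= (2 * expR (a ^+ 2 * s ^+ 2 / 2))%:E)%E.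
Proof.
move=> [mY gY] sle.
have s0 : 0 <= s by apply: le_trans sle; exact: sqrtr_ge0.
have mexp (b : R) : measurable_fun setT (fun x : R => expR (b * x)).
  by apply: measurableT_comp => //; exact: measurable_funM.
have key (b : R) :
    (\int[P]_w (expR (b * Y w))%:E <= (expR (b ^+ 2 * s ^+ 2 / 2))%:E)%E.
  have e0 x : 0 <= expR (b * x) by exact: expR_ge0.
  case: gY sle => [PY _|[s' [s'0 PY]] sle].
    rewrite (@centered_gaussian_integral _ _ _ P Y (@dirac _ (measurableTypeR R) 0 R) _ mY PY (mexp b) e0).
    rewrite integral_dirac//; last by apply/measurable_EFinP; exact: mexp.
    rewrite diracT mul1e mulr0 expR0 lee_fin -expR0 ler_expR.
    by rewrite divr_ge0// mulr_ge0// sqr_ge0.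
  have [v Iv s'v] := normal_second_moment s'0.
  have ss' : s' <= s.
    apply: le_trans sle; rewrite -(gtr0_norm s'0) -sqrtr_sqr.
    apply: ler_wsqrtr.
    have -> := @centered_gaussian_integral _ _ _ P Y (normal_prob 0 s') _ mY PY
      (measurable_funX 2 (@measurable_id _ R setT)) (@sqr_ge0 R).
    by rewrite [X in fine X]Iv.
  rewrite (@centered_gaussian_integral _ _ _ P Y (normal_prob 0 s') _ mY PY (mexp b) e0).
  rewrite [leLHS](normal_mgf b s'0) lee_fin ler_expR ler_pM2r ?invr_gt0//.
  by rewrite ler_wpM2l ?sqr_ge0// lerXn2r ?nnegrE// ltW.
have mexpY (b : R) : measurable_fun setT (fun w => (expR (b * Y w))%:E).
  by apply/measurable_EFinP; exact: (measurableT_comp (mexp b) mY).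
apply: (@le_trans _ _ (\int[P]_w ((expR (a * Y w))%:E + (expR (- a * Y w))%:E))%E).
  apply: ge0_le_integral => //.
  - apply/measurable_EFinP; apply: (measurableT_comp (mexp a)).
    exact: measurableT_comp.
  - exact: emeasurable_funD.
  - move=> w _ /=; rewrite -EFinD lee_fin.
    have [Y0|Y0] := leP 0 (Y w).
      by rewrite ger0_norm// lerDl expR_ge0.
    by rewrite ltr0_norm// mulrN -mulNr lerDr expR_ge0.
rewrite ge0_integralD// mulr_natl mulr2n EFinD.
by apply: leeD; rewrite ?key//; have := key (- a); rewrite sqrrN.
Qed.

(** * Convexity and Jensen's inequality with geometric weights *)

(** The tangent at the weighted mean [c] lies below exp, and averaging it over the two points gives
    back exp c. *)
Lemma expR_convex (R : realType) (x y a : R) : 0 <= a <= 1 ->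
  expR (a * x + (1 - a) * y) <= a * expR x + (1 - a) * expR y.
Proof.
have tangent (c z : R) : expR c * (1 + (z - c)) <= expR z.
  have -> : expR z = expR c * expR (z - c) by rewrite -expRD subrKC.
  by rewrite ler_pM2l ?expR_gt0// expR_ge1Dx.
move=> /andP[a0 a1]; set c := a * x + (1 - a) * y.
have -> : expR c = a * (expR c * (1 + (x - c))) + (1 - a) * (expR c * (1 + (y - c))).
  by move: (expR c) => e; rewrite /c; ring.
by apply: lerD; rewrite ler_wpM2l ?subr_ge0// tangent.
Qed.

(** Two-point convexity repeatedly splits the last weight q^K into (1 - q) q^K and q^(K+1). The
    domain [D] allows both exp on the line and [r \o expR] on the half-line. *)
Lemma geometric_jensen (R : realFieldType) (D : R -> Prop) (f : R -> R) (q : R) :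
  0 <= q <= 1 ->
  (forall x y a, D x -> D y -> 0 <= a <= 1 -> D (a * x + (1 - a) * y)) ->
  (forall x y a, D x -> D y -> 0 <= a <= 1 ->
     f (a * x + (1 - a) * y) <= a * f x + (1 - a) * f y) ->
  forall (K : nat) (z : nat -> R) (y : R), (forall k, D (z k)) -> D y ->
  f (\sum_(k < K) (1 - q) * q ^+ k * z k + q ^+ K * y) <=
  \sum_(k < K) (1 - q) * q ^+ k * f (z k) + q ^+ K * f y.
Proof.
move=> /andP[q0 q1] Dconv fconv K z + Dz.
elim: K => [|K IH] y Dy; first by rewrite !big_ord0 !add0r !expr0 !mul1r.
have p01 : 0 <= 1 - q <= 1 by rewrite subr_ge0 q1 gerBl.
have := IH _ (Dconv _ _ _ (Dz K) Dy p01).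
have := ler_wpM2l (exprn_ge0 K q0) (fconv _ _ _ (Dz K) Dy p01).
rewrite !big_ord_recr/= exprS.
set S1 := \sum_(k < K) _; set S2 := \sum_(k < K) _.
have -> : S1 + (1 - q) * q ^+ K * z K + q * q ^+ K * y =
  S1 + q ^+ K * ((1 - q) * z K + (1 - (1 - q)) * y) by ring.
move=> h1 /le_trans; apply; rewrite -addrA lerD2l (le_trans h1)//.
by rewrite le_eqVlt; apply/orP; left; apply/eqP; ring.
Qed.

(** * Covering numbers and the entropy integral *)

Definition ball_cover (R : realType) (T : Type) (rho : T -> T -> R) (u : R) (n : nat) :=
  exists c : nat -> T, forall t : T, exists2 i, (i < n)%N & rho (c i) t < u.

Lemma ball_cover_gt0 (R : realType) (T : Type) (rho : T -> T -> R) (u : R)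
  (n : nat) (t : T) : ball_cover rho u n -> (0 < n)%N.
Proof. by move=> [c /(_ t)[i]]; case: n. Qed.

(** A finite infimum is taken over a nonempty set of integers, so the least one provides an actual
    minimal net. *)
Lemma massiveness_attained (R : realType) (T : Type) (rho : T -> T -> R) (u : R) :
  (massiveness rho u < +oo)%E ->
  exists2 n : nat, massiveness rho u = (n%:R)%:E & ball_cover rho u n.
Proof.
move=> /ereal_inf_lt[_ [n0 cn0 <-] _].
have ex : exists n, `[< ball_cover rho u n >] by exists n0; exact/asboolP.
case: (ex_minnP ex) => n /asboolP cn nmin; exists n => //.
apply/eqP; rewrite eq_le; apply/andP; split.
  by apply: ereal_inf_lbound; exists n.
apply: le_ereal_inf_tmp => _ [k ck <-]; rewrite lee_fin ler_nat.
by apply: nmin; exact/asboolP.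
Qed.

Lemma massiveness_ge1 (R : realType) (T : Type) (rho : T -> T -> R) (u : R) (t : T) :
  (1 <= massiveness rho u)%E.
Proof.
apply: le_ereal_inf_tmp => _ [k ck <-]; rewrite lee_fin ler1n.
exact: ball_cover_gt0 t ck.
Qed.

Lemma massiveness_anti (R : realType) (T : Type) (rho : T -> T -> R) (u v : R) :
  u <= v -> (massiveness rho v <= massiveness rho u)%E.
Proof.
move=> uv; apply: ereal_inf_le_tmp => _ [k [c ck] <-]; exists k => //.
by exists c => t; have [i ik cit] := ck t; exists i => //; exact: lt_le_trans uv.
Qed.

Section entropy_integral.
Variables (R : realType) (T : Type) (rho : T -> T -> R) (r : R -> R) (t0 : T).
Hypothesis r0 : forall u, 1 <= u -> 0 <= r u.
Hypothesis r_nd : forall u v, 1 <= u -> u <= v -> r u <= r v.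

Lemma rN_ge (u b : R) : (b%:E <= massiveness rho u)%E -> 1 <= b ->
  ((r b)%:E <= rN r rho u)%E.
Proof.
rewrite /rN; case: (massiveness rho u) => [a| |]; rewrite ?leey//.
by rewrite !lee_fin => ba b1; exact: r_nd.
Qed.

Lemma rN_ge1 (u : R) : ((r 1)%:E <= rN r rho u)%E.
Proof. by apply: rN_ge => //; exact: massiveness_ge1. Qed.

Lemma rN_ge0 (u : R) : (0 <= rN r rho u)%E.
Proof. by apply: le_trans (rN_ge1 u); rewrite lee_fin r0. Qed.

Lemma rN_anti (u v : R) : u <= v -> (rN r rho v <= rN r rho u)%E.
Proof.
move=> uv; have := massiveness_anti rho uv; have := massiveness_ge1 rho v t0.
case E : (massiveness rho v) => [a| |]//.
  by move=> a1 au; rewrite {1}/rN E; exact: rN_ge.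
by move=> _; rewrite leye_eq => /eqP E'; rewrite /rN E' leey.
Qed.

(** Superlevel sets of an antitone function are intervals. *)
Lemma measurable_rN (D : set (measurableTypeR R)) : measurable_fun D (rN r rho).
Proof.
apply: (@measurable_funS _ _ _ _ setT) => //.
move=> _; apply: (measurability _ (ErealGenCInfty.measurableE R)) => //.
move=> _ [_ [y ->] <-]; rewrite setTI.
apply: is_interval_measurable => a b /=; rewrite !in_itv/= !andbT => _ yb v /andP[_ vb].
by rewrite in_itv/= andbT; exact: (le_trans yb (rN_anti vb)).
Qed.

Lemma integral_rN_ge (a b c : R) : a <= b -> (c%:E <= rN r rho b)%E -> 0 <= c ->
  (((b - a) * c)%:E <= \int[lebesgue_measure]_(v in `]a, b]) rN r rho v)%E.
Proof.
move=> ab cb c0.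
apply: (@le_trans _ _ (\int[lebesgue_measure]_(v in `]a, b]) cst c%:E v)%E).
  rewrite integral_cst//= lebesgue_measure_itv/= lte_fin mulrC.
  by move: ab; rewrite le_eqVlt => /predU1P[->|->]; rewrite ?ltxx ?subrr ?mulr0 ?mule0.
apply: ge0_le_integral => //=.
  by move=> x; exact: measurable_rN.
move=> v; rewrite in_itv/= => /andP[_ vb].
exact: le_trans cb (rN_anti vb).
Qed.

Lemma IrE (x : R) : Ir r rho x = (\int[lebesgue_measure]_(v in `]0%R, x]) rN r rho v)%E.
Proof. by rewrite set_itvoc. Qed.

Lemma Ir_split (x y : R) : 0 <= x -> x <= y ->
  Ir r rho y = (Ir r rho x + \int[lebesgue_measure]_(v in `]x, y]) rN r rho v)%E.
Proof.
move=> x0 xy; rewrite !IrE.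
have U : [set` `]0, y]] = `]0, x] `|` `]x, y].
  by rewrite -itv_bndbnd_setU// bnd_simp.
rewrite U ge0_integral_setU//.
- exact: measurable_rN.
- by move=> v _; exact: rN_ge0.
- apply/disj_set2P/seteqP; split => // v [/=]; rewrite !in_itv/= => /andP[_ vx] /andP[].
  by rewrite ltNge vx.
Qed.

(* [(1 - q) q^k x] is the length of [`]q^(k+1) x, q^k x]], on which [rN] is at least
   [r (N k)]. *)
Lemma Ir_geometric (q x : R) (N : nat -> R) (K : nat) : 0 < q < 1 -> 0 < x ->
  (forall k, massiveness rho (q ^+ k * x) = (N k)%:E) ->
  ((x * (\sum_(k < K) (1 - q) * q ^+ k * r (N k) + q ^+ K * r 1))%:E
     <= Ir r rho x)%E.
Proof.
move=> /andP[q0 q1]; elim: K x N => [|K IH] x N x0 hN.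
  rewrite big_ord0 add0r mul1r IrE -[X in (X * _)%:E]subr0.
  by apply: integral_rN_ge; [exact: ltW|exact: rN_ge1|exact: r0].
(* Split at [q * x]: the induction hypothesis covers the lower part, with the covering numbers
   shifted by one level. *)
have qx0 : 0 < q * x by rewrite mulr_gt0.
have qxx : q * x <= x by rewrite ger_pMl// ltW.
rewrite (Ir_split (ltW qx0) qxx).
have hN' k : massiveness rho (q ^+ k * (q * x)) = (N k.+1)%:E.
  by rewrite mulrA -exprSr hN.
have N01 : 1 <= N 0%N by rewrite -lee_fin -hN; exact: massiveness_ge1.
have h1 : (((x - q * x) * r (N 0%N))%:E <=
    \int[lebesgue_measure]_(v in `](q * x)%R, x]) rN r rho v)%E.
  apply: integral_rN_ge => //; last exact: r0.
  by apply: rN_ge => //; rewrite -hN expr0 mul1r.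
apply: le_trans (leeD (IH _ _ qx0 hN') h1).
rewrite -EFinD lee_fin big_ord_recl/= expr0 le_eqVlt; apply/orP; left; apply/eqP.
have -> : \sum_(i < K) (1 - q) * q ^+ bump 0 i * r (N (bump 0 i)) =
    q * \sum_(k < K) (1 - q) * q ^+ k * r (N k.+1).
  by rewrite mulr_sumr; apply: eq_bigr => k _; rewrite /bump/= add1n exprS; ring.
by rewrite exprS; ring.
Qed.

Lemma Ir_le (x y : R) : 0 <= x -> x <= y -> (Ir r rho x <= Ir r rho y)%E.
Proof.
move=> x0 xy; rewrite (Ir_split x0 xy) leeDl//.
by apply: integral_ge0 => v _; exact: rN_ge0.
Qed.

(** An infinite covering number at [x] would make [rN] infinite on all of ]0, x], and the integral
    with it. *)
Lemma massiveness_lty (x y : R) : 0 < x -> x <= y -> (Ir r rho y < +oo)%E ->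
  (massiveness rho x < +oo)%E.
Proof.
move=> x0 xy; apply: contraTT; rewrite -!leNgt leye_eq => /eqP Nx.
apply: le_trans (Ir_le (ltW x0) xy); rewrite IrE.
apply: (@le_trans _ _ (\int[lebesgue_measure]_(v in `]0%R, x]) cst +oo%E v)%E).
  rewrite integral_cst//= lebesgue_measure_itv/= lte_fin x0 oppr0 adde0.
  by rewrite gt0_mulye ?lte_fin.
apply: ge0_le_integral => //=.
  by move=> v; exact: measurable_rN.
move=> v; rewrite in_itv/= => /andP[_ /rN_anti]; apply: le_trans.
by rewrite /rN Nx.
Qed.

End entropy_integral.

(** The geometric mean is admissible in the supremum defining [rinv]: it is at least 1, and Jensen
    for [r \o expR] bounds its image under [r] by a lower sum for the integral divided by [x]. *)
Lemma rinv_ge_geometric (R : realType) (T : Type) (rho : T -> T -> R)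
  (r : R -> R) (t0 : T) (q x : R) (N : nat -> R) (K : nat) :
  (forall u, 1 <= u -> 0 <= r u) ->
  (forall u v, 1 <= u -> u <= v -> r u <= r v) ->
  (forall (x y a : R), 0 <= x -> 0 <= y -> 0 <= a <= 1 ->
     r (expR (a * x + (1 - a) * y)) <= a * r (expR x) + (1 - a) * r (expR y)) ->
  0 < q < 1 -> 0 < x ->
  (forall k, massiveness rho (q ^+ k * x) = (N k)%:E) ->
  ((expR (\sum_(k < K) (1 - q) * q ^+ k * ln (N k)))%:E
     <= rinv r (Ir r rho x * (x^-1)%:E))%E.
Proof.
move=> r0 r_nd r_conv q01 x0 hN; have /andP[q0 q1] := q01.
have N1 k : 1 <= N k by rewrite -lee_fin -hN; exact: massiveness_ge1.
apply: ereal_sup_ubound; exists (expR (\sum_(k < K) (1 - q) * q ^+ k * ln (N k))) => //.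
split.
  rewrite -[leLHS]expR0 ler_expR sumr_ge0// => k _.
  by rewrite mulr_ge0 ?ln_ge0// mulr_ge0 ?subr_ge0 ?exprn_ge0 ?(ltW q0) ?(ltW q1).
rewrite lee_pdivlMr// -EFinM.
apply: le_trans (Ir_geometric t0 r0 r_nd K q01 x0 hN).
rewrite lee_fin mulrC ler_pM2l//.
have q01' : 0 <= q <= 1 by rewrite (ltW q0) (ltW q1).
have := @geometric_jensen _ (fun z => 0 <= z) (r \o expR) q q01'.
(* The remaining weight q^K sits at 0 = ln 1, which matches the term q^K r(1) of the lower sum. *)
move=> /(_ _ _ K (fun k => ln (N k)) 0)/=; rewrite mulr0 addr0 expR0.
have -> : \sum_(k < K) (1 - q) * q ^+ k * r (expR (ln (N k))) =
    \sum_(k < K) (1 - q) * q ^+ k * r (N k).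
  by apply: eq_bigr => k _; rewrite lnK// posrE (lt_le_trans ltr01).
apply => //; last by move=> k /=; rewrite ln_ge0.
move=> y z a y0 z0 /andP[a0 a1].
by rewrite addr_ge0// mulr_ge0// subr_ge0.
Qed.

(** * Upper bounds on means *)

Section mean_le.
Variables (d : measure_display) (Omega : measurableType d) (R : realType).
Variable P : probability Omega R.

(** Carries measurability and nonnegativity along, so that bounds add and scale without side
    conditions. *)
Definition mean_le (g : Omega -> R) (b : R) :=
  [/\ measurable_fun setT g, forall w, 0 <= g w & (\int[P]_w (g w)%:E <= b%:E)%E].

Lemma mean_leD (g h : Omega -> R) (a b : R) : mean_le g a -> mean_le h b ->
  mean_le (g \+ h) (a + b).
Proof.
move=> [mg g0 ga] [mh h0 hb]; split.
- exact: measurable_funD.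
- by move=> w; rewrite addr_ge0.
- under eq_integral do rewrite EFinD.
  rewrite ge0_integralD//; last 4 first.
  + by move=> w _; rewrite lee_fin.
  + exact/measurable_EFinP.
  + by move=> w _; rewrite lee_fin.
  + exact/measurable_EFinP.
  by rewrite EFinD leeD.
Qed.

Lemma mean_leZ (g : Omega -> R) (a c : R) : 0 <= c -> mean_le g a ->
  mean_le (fun w => c * g w) (c * a).
Proof.
move=> c0 [mg g0 ga]; split.
- exact: measurable_funM.
- by move=> w; rewrite mulr_ge0.
- under eq_integral do rewrite EFinM.
  rewrite ge0_integralZl//; last 2 first.
  + exact/measurable_EFinP.
  + by move=> w _; rewrite lee_fin.
  by rewrite EFinM lee_wpmul2l.
Qed.

Lemma mean_le_sum (n : nat) (g : nat -> Omega -> R) (a : nat -> R) :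
  (forall i, mean_le (g i) (a i)) ->
  mean_le (fun w => \sum_(i < n) g i w) (\sum_(i < n) a i).
Proof.
move=> ga; elim: n => [|n IH].
  split; first by under eq_fun do rewrite big_ord0; exact: measurable_cst.
    by move=> w; rewrite big_ord0.
  by under eq_integral do rewrite big_ord0; rewrite big_ord0 integral0.
under eq_fun do rewrite big_ord_recr/=; rewrite big_ord_recr/=.
exact: mean_leD.
Qed.

End mean_le.

Lemma sum_geometric_weights (R : comNzRingType) (q : R) (K : nat) :
  \sum_(k < K) (1 - q) * q ^+ k + q ^+ K = 1.
Proof.
elim: K => [|K IH]; first by rewrite big_ord0 add0r.
by rewrite -[RHS]IH big_ord_recr/= exprS; ring.
Qed.

(** * Chaining *)

Section chaining.
Variables (R : realType) (d : measure_display) (Omega : measurableType d).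
Variables (P : probability Omega R) (T : Type) (X : T -> Omega -> R).
Variables (alpha : nat -> T -> T) (c : nat -> nat -> T) (N : nat -> nat).
Variables (m q : R).
Hypothesis (q0 : 0 < q) (q1 : q < 1).
Hypothesis alphaP : forall k t, exists2 i, (i < N k)%N & alpha k t = c k i.

(** Link 0 is the value itself; link k+1 leads to the net of level k, whose radius will be q^(k+1)
    m. *)
Definition link (k : nat) (t : T) (w : Omega) : R :=
  if k is k'.+1 then X t w - X (alpha k' t) w else X t w.

(** The chain starts at [s] and applies [alpha] from level K-1 down to 0; it does not depend on
    [w]. *)
Lemma chain_decomposition (K : nat) (s : T) : exists tau : nat -> T,
  (forall k, (k < K)%N -> exists2 i, (i < N k)%N & tau k = c k i) /\
  forall w, X s w = link K s w + \sum_(k < K) link k (tau k) w.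
Proof.
elim: K s => [|K IH] s.
  by exists (fun=> s); split => // w; rewrite big_ord0 addr0.
have [tau [tauc tauE]] := IH (alpha K s).
exists (fun k => if k == K then alpha K s else tau k); split.
  move=> k; rewrite ltnS leq_eqVlt; case: eqVneq => [->|_ /= kK]; last exact: tauc.
  by move=> _; exact: alphaP.
move=> w; rewrite big_ord_recr/= eqxx.
under eq_bigr => k _ do rewrite ltn_eqF//.
by rewrite [_ + link _ _ _]addrC -tauE subrK.
Qed.

Variable l : R.
Hypothesis l0 : 0 < l.
Let A := l ^+ 2 * m ^+ 2 / (2 * (1 - q) ^+ 2).

Hypothesis link_mean : forall k t a,
  mean_le P (fun w => expR (a * `|link k t w|))
    (2 * expR (a ^+ 2 * (q ^+ k * m) ^+ 2 / 2)).

(** Dividing each link by its weight cancels q^k, so every exponential has mean at most 2 exp A. [G]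
    is exp S times a weighted average of sums [L k], [L'] normalised to have mean at most 1. *)
Lemma finite_chaining (J K : nat) (s : nat -> T) : (0 < J)%N -> exists2 G : Omega -> R,
  mean_le P G (2 * expR A *
    expR (\sum_(k < K) (1 - q) * q ^+ k * ln (N k)%:R) * expR (q ^+ K * ln J%:R)) &
  forall w j, (j < J)%N -> expR (l * `|X (s j) w|) <= G w.
Proof.
move=> J0.
have p0 k : 0 < (1 - q) * q ^+ k by rewrite mulr_gt0 ?subr_gt0 ?exprn_gt0.
have qK0 : 0 < q ^+ K by rewrite exprn_gt0.
have N0 k : 0 < (N k)%:R :> R.
  by rewrite ltr0n; have [i iN _] := alphaP k (s 0%N); exact: leq_ltn_trans iN.
have JR0 : 0 < J%:R :> R by rewrite ltr0n.
(* [B n] bounds the mean of a sum of [n] exponentials of rescaled links. *)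
pose B (n : nat) := n%:R * (2 * expR A).
have B0 (n : nat) : 0 < n%:R :> R -> 0 < B n.
  by move=> n0; rewrite !mulr_gt0 ?expR_gt0.
(* As the weights sum to 1, the common factor 2 exp A appears exactly once in exp S. *)
pose S := \sum_(k < K) (1 - q) * q ^+ k * ln (B (N k)) + q ^+ K * ln (B J).
have SE : expR S = 2 * expR A *
    expR (\sum_(k < K) (1 - q) * q ^+ k * ln (N k)%:R) * expR (q ^+ K * ln J%:R).
  have lnB (n : nat) : 0 < n%:R :> R -> ln (B n) = ln (2 * expR A) + ln n%:R.
    by move=> n0; rewrite /B lnM ?posrE ?mulr_gt0 ?expR_gt0// addrC.
  have -> : 2 * expR A = expR (ln (2 * expR A)).
    by rewrite lnK// posrE mulr_gt0 ?expR_gt0.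
  rewrite -!expRD; congr expR; rewrite /S lnB//.
  under eq_bigr => k _ do rewrite lnB// mulrDr.
  rewrite big_split/= -mulr_suml mulrDr.
  set lnA := ln (2 * expR A).
  have lnAE : (\sum_(k < K) (1 - q) * q ^+ k) * lnA + q ^+ K * lnA = lnA.
    by rewrite -mulrDl sum_geometric_weights mul1r.
  by rewrite -[X in _ = X + _ + _]lnAE; ring.
pose L k w := \sum_(i < N k) expR (l / ((1 - q) * q ^+ k) * `|link k (c k i) w|).
pose L' w := \sum_(j < J) expR (l / q ^+ K * `|link K (s j) w|).
exists (fun w => expR S * (\sum_(k < K) (1 - q) * q ^+ k * ((B (N k))^-1 * L k w)
                           + q ^+ K * ((B J)^-1 * L' w))).
  rewrite -SE -[X in mean_le _ _ X]mulr1.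
  apply: mean_leZ; first exact: expR_ge0.
  rewrite -[X in mean_le _ _ X](sum_geometric_weights q K).
  apply: mean_leD.
    apply: (@mean_le_sum _ _ _ _ _
      (fun k w => (1 - q) * q ^+ k * ((B (N k))^-1 * L k w))
      (fun k => (1 - q) * q ^+ k)) => k.
    rewrite -[X in mean_le _ _ X]mulr1; apply: mean_leZ; first exact: ltW.
    rewrite -(mulVf (lt0r_neq0 (B0 _ (N0 k)))); apply: mean_leZ.
      by rewrite invr_ge0; exact/ltW/B0/N0.
    have -> : B (N k) = \sum_(i < N k) 2 * expR A.
      by rewrite sumr_const card_ord /B mulr_natl.
    apply: (@mean_le_sum _ _ _ _ _
      (fun i w => expR (l / ((1 - q) * q ^+ k) * `|link k (c k i) w|))
      (fun=> 2 * expR A)) => i.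
    have -> : A = (l / ((1 - q) * q ^+ k)) ^+ 2 * (q ^+ k * m) ^+ 2 / 2.
      by rewrite /A; field; rewrite !gt_eqF ?exprn_gt0 ?subr_gt0.
    exact: link_mean.
  rewrite -[X in mean_le _ _ X]mulr1; apply: mean_leZ; first exact: ltW.
  rewrite -(mulVf (lt0r_neq0 (B0 _ JR0))); apply: mean_leZ.
    by rewrite invr_ge0; exact/ltW/B0.
  have -> : B J = \sum_(i < J) 2 * expR A by rewrite sumr_const card_ord /B mulr_natl.
  apply: (@mean_le_sum _ _ _ _ _
    (fun i w => expR (l / q ^+ K * `|link K (s i) w|)) (fun=> 2 * expR A)) => i.
  (* The last weight has no factor 1 - q, so the exponent is l^2 m^2 / 2, which is below [A]. *)
  have [mZ Z0 Zle] := link_mean K (s i) (l / q ^+ K); split => //.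
  apply: (le_trans Zle); rewrite lee_fin ler_pM2l// ler_expR.
  have -> : (l / q ^+ K) ^+ 2 * (q ^+ K * m) ^+ 2 / 2 = l ^+ 2 * m ^+ 2 / 2.
    by field; rewrite gt_eqF.
  have -> : A = l ^+ 2 * m ^+ 2 / 2 * (1 - q) ^- 2.
    by rewrite /A; field; rewrite gt_eqF ?subr_gt0.
  rewrite ler_peMr//.
    by rewrite divr_ge0// mulr_ge0// sqr_ge0.
  rewrite invf_ge1 ?exprn_gt0 ?subr_gt0// exprn_ile1 ?subr_ge0 ?(ltW q1)//.
  by rewrite gerBl ltW.
move=> w j jJ; have [tau [tauc tauE]] := chain_decomposition K (s j).
(* The subtracted logarithms become the divisions by [B] in [G]; their weighted sum is [S], which is
   restored outside. *)
pose z k := l / ((1 - q) * q ^+ k) * `|link k (tau k) w| - ln (B (N k)).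
pose y := l / q ^+ K * `|link K (s j) w| - ln (B J).
apply: (@le_trans _ _ (expR (S + (\sum_(k < K) (1 - q) * q ^+ k * z k + q ^+ K * y)))).
  rewrite ler_expR.
  have -> : S + (\sum_(k < K) (1 - q) * q ^+ k * z k + q ^+ K * y) =
      l * (\sum_(k < K) `|link k (tau k) w| + `|link K (s j) w|).
    rewrite /S addrACA -big_split/= [in RHS]mulrDr mulr_sumr; congr (_ + _).
      apply: eq_bigr => k _; rewrite /z -mulrDr subrKC mulrA; congr (_ * _).
      by rewrite mulrC divfK// gt_eqF.
    by rewrite /y -mulrDr subrKC mulrA; congr (_ * _); rewrite mulrC divfK// gt_eqF.
  rewrite ler_pM2l// tauE addrC (le_trans (ler_normD _ _))// lerD2r.
  exact: ler_norm_sum.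
rewrite expRD ler_pM2l ?expR_gt0//.
have q01 : 0 <= q <= 1 by rewrite (ltW q0) (ltW q1).
have cvx (u v a : R) : True -> True -> 0 <= a <= 1 ->
    expR (a * u + (1 - a) * v) <= a * expR u + (1 - a) * expR v.
  by move=> _ _; exact: expR_convex.
have := @geometric_jensen _ (fun=> True) (@expR R) q q01 (fun _ _ _ _ _ _ => I) cvx K z y
          (fun=> I) I.
move=> /le_trans; apply; apply: lerD.
  apply: ler_sum => k _; rewrite ler_pM2l// /z expRD expRN lnK ?posrE ?(B0 _ (N0 k))// mulrC.
  rewrite ler_pM2l ?invr_gt0 ?(B0 _ (N0 k))//.
  (* The link of this chain is one term of the sum over the whole net. *)
  have [i iN ->] := tauc k (ltn_ord k).
  rewrite /L (bigD1 (Ordinal iN))//= lerDl sumr_ge0// => ? _; exact: expR_ge0.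
rewrite ler_pM2l// /y expRD expRN lnK ?posrE ?B0// mulrC.
rewrite ler_pM2l ?invr_gt0 ?B0//.
rewrite /L' (bigD1 (Ordinal jJ))//= lerDl sumr_ge0// => ? _; exact: expR_ge0.
Qed.

End chaining.

(** * Maxima of a Gaussian process over finite sets and sequences *)

Section gaussian_process.
Variables (R : realType) (d : measure_display) (Omega : measurableType d).
Variables (P : probability Omega R) (T : Type) (X : T -> Omega -> R).
Hypothesis gX : centered_gaussian_process P X.

Lemma centered_gaussian_process_rv (t : T) : centered_gaussian_rv P (X t).
Proof.
have := gX (fun _ : 'I_1 => t) (fun=> 1).
suff -> : (fun w => \sum_(i < 1) 1 * X t w) = X t by [].
by apply/funext => w; rewrite big_ord1 mul1r.
Qed.

Lemma centered_gaussian_process_diff (t s : T) :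
  centered_gaussian_rv P (fun w => X t w - X s w).
Proof.
have := gX (fun i : 'I_2 => if i == ord0 then t else s)
           (fun i : 'I_2 => if i == ord0 then 1 else -1).
set F := (fun w => \sum_(i < 2) _); suff -> : F = (fun w => X t w - X s w) by [].
by apply/funext => w; rewrite /F big_ord_recl big_ord1/= mul1r mulN1r.
Qed.

Lemma rhoX_sym (t s : T) : rhoX P X t s = rhoX P X s t.
Proof.
rewrite /rhoX; congr (Num.sqrt (fine _)); apply: eq_integral => w _.
by rewrite -opprB sqrrN.
Qed.

Lemma sd_le_msup (t : T) : (msup P X < +oo)%E ->
  Num.sqrt (fine (\int[P]_w ((X t w) ^+ 2)%:E)%E) <= fine (msup P X).
Proof.
move=> fin.
have ub : ((Num.sqrt (fine (\int[P]_w ((X t w) ^+ 2)%:E)))%:E <= msup P X)%E.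
  by apply: ereal_sup_ubound; exists t.
have mfin : msup P X \is a fin_num.
  by rewrite ge0_fin_numE//; apply: le_trans ub; rewrite lee_fin sqrtr_ge0.
by rewrite -lee_fin fineK.
Qed.

Lemma mean_le_expR_norm (Y : Omega -> R) (s a : R) : centered_gaussian_rv P Y ->
  Num.sqrt (fine (\int[P]_w ((Y w) ^+ 2)%:E)%E) <= s ->
  mean_le P (fun w => expR (a * `|Y w|)) (2 * expR (a ^+ 2 * s ^+ 2 / 2)).
Proof.
move=> gY sle; split.
- apply: measurableT_comp => //; apply: measurable_funM => //.
  by apply: measurableT_comp => //; case: gY.
- by move=> w; exact: expR_ge0.
- exact: centered_gaussian_expR_norm.
Qed.

(** Starting from 0 keeps the maximum nonnegative and nondecreasing in [J]. *)
Fixpoint max_expR (l : R) (e : nat -> T) (J : nat) (w : Omega) : R :=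
  if J is J'.+1 then Num.max (max_expR l e J' w) (expR (l * `|X (e J') w|)) else 0.

Lemma measurable_max_expR (l : R) (e : nat -> T) (J : nat) :
  measurable_fun setT (max_expR l e J).
Proof.
elim: J => [|J IH]; first exact: measurable_cst.
apply: measurable_maxr => //.
by have [] := mean_le_expR_norm l (centered_gaussian_process_rv (e J)) (lexx _).
Qed.

Lemma max_expR_nd (l : R) (e : nat -> T) (w : Omega) :
  {homo (fun J => max_expR l e J w) : i j / (i <= j)%N >-> i <= j}.
Proof. by apply/nondecreasing_seqP => J /=; rewrite le_max lexx. Qed.

Lemma max_expR_le (l : R) (e : nat -> T) (J : nat) (w : Omega) (b : R) : 0 <= b ->
  (forall j, (j < J)%N -> expR (l * `|X (e j) w|) <= b) -> max_expR l e J w <= b.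
Proof.
move=> b0; elim: J => [|J IH]//= eb.
by rewrite ge_max eb// IH// => j jJ; apply: eb; exact: ltnW.
Qed.

Lemma max_expR_ge0 (l : R) (e : nat -> T) (J : nat) (w : Omega) : 0 <= max_expR l e J w.
Proof. exact: (max_expR_nd l e w (leq0n J)). Qed.

Section entropy.
Variables (r : R -> R) (q l : R) (t0 : T).
Local Notation m := (fine (msup P X)).
Hypothesis (msup0 : (0 < msup P X)%E) (msupy : (msup P X < +oo)%E).
Hypothesis r0 : forall u, 1 <= u -> 0 <= r u.
Hypothesis r_nd : forall u v, 1 <= u -> u <= v -> r u <= r v.
Hypothesis r_conv : forall (x y a : R), 0 <= x -> 0 <= y -> 0 <= a <= 1 ->
  r (expR (a * x + (1 - a) * y)) <= a * r (expR x) + (1 - a) * r (expR y).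
Hypothesis Iry : (Ir r (rhoX P X) m < +oo)%E.
Hypothesis (q01 : 0 < q < 1) (l0 : 0 < l).

Let C := 2 * expR (l ^+ 2 * m ^+ 2 / (2 * (1 - q) ^+ 2)).
Let B := rinv r (Ir r (rhoX P X) (q * m) * ((q * m)^-1)%:E)%E.

Lemma msup_gt0 : 0 < m.
Proof. by rewrite fine_gt0// msup0. Qed.

(** Chaining through minimal nets of radii q^(k+1) m, with projections [alpha]. [U] is the geometric
    mean of covering numbers at depth [K], while its bound [B] is free of [K]. *)
Lemma max_expR_mean_le (e : nat -> T) (J K : nat) : (0 < J)%N -> exists2 U : R,
  (U%:E <= B)%E &
  (\int[P]_w (max_expR l e J w)%:E <= (C * U * expR (q ^+ K * ln J%:R))%:E)%E.
Proof.
move=> J0; have m0 := msup_gt0; have /andP[q0 q1] := q01.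
have qm0 : 0 < q * m by rewrite mulr_gt0.
have cov k : exists n : nat,
    massiveness (rhoX P X) (q ^+ k * (q * m)) = (n%:R)%:E /\
    ball_cover (rhoX P X) (q ^+ k * (q * m)) n.
  have [|n ? ?] := @massiveness_attained _ _ (rhoX P X) (q ^+ k * (q * m)); last by exists n.
  apply: (massiveness_lty t0 r0 r_nd _ _ Iry); first by rewrite mulr_gt0// exprn_gt0.
  by rewrite mulrA -exprSr ger_pMl// exprn_ile1// ltW.
have [N /all_and2[NE Ncov]] := choice cov.
have [c cP] := choice Ncov.
have close k : exists f : T -> T, forall t, (exists2 i, (i < N k)%N & f t = c k i) /\
    rhoX P X (f t) t < q ^+ k * (q * m).
  suff /choice[f fP] : forall t, exists s, (exists2 i, (i < N k)%N & s = c k i) /\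
    rhoX P X s t < q ^+ k * (q * m) by exists f.
  by move=> t; have [i iN cit] := cP k t; exists (c k i); split => //; exists i.
have [alpha alphaP] := choice close.
have alphac k t : exists2 i, (i < N k)%N & alpha k t = c k i by case: (alphaP k t).
have link_mean k t a : mean_le P (fun w => expR (a * `|link X alpha k t w|))
    (2 * expR (a ^+ 2 * (q ^+ k * m) ^+ 2 / 2)).
  case: k => [|k].
    apply: mean_le_expR_norm; first exact: centered_gaussian_process_rv.
    by rewrite expr0 mul1r; exact: sd_le_msup.
  apply: mean_le_expR_norm; first exact: centered_gaussian_process_diff.
  rewrite exprSr -mulrA -/(rhoX P X t (alpha k t)) rhoX_sym.
  by case: (alphaP k t) => _ /ltW.
have [G [mG G0 GC] maxG] := finite_chaining q0 q1 alphac l0 link_mean K e J0.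
exists (expR (\sum_(k < K) (1 - q) * q ^+ k * ln (N k)%:R)).
  exact: (@rinv_ge_geometric _ _ _ _ t0 q _ (fun k => (N k)%:R) K r0 r_nd r_conv q01 qm0).
apply: le_trans GC; apply: ge0_le_integral => //.
- by move=> w _; rewrite lee_fin max_expR_ge0.
- exact/measurable_EFinP/measurable_max_expR.
- exact/measurable_EFinP.
- by move=> w _; rewrite lee_fin max_expR_le// => j; exact: maxG.
Qed.

(** The left side does not involve the depth K, and J^(q^K) tends to 1. *)
Lemma max_expR_mean_rinv (e : nat -> T) (J : nat) :
  (\int[P]_w (max_expR l e J w)%:E <= C%:E * B)%E.
Proof.
have C0 : 0 < C by rewrite mulr_gt0// expR_gt0.
wlog J0 : J / (0 < J)%N.
  case: J => [H|J]; last by apply.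
  apply: le_trans (H 1%N isT); apply: ge0_le_integral => //.
  - exact/measurable_EFinP/measurable_max_expR.
  - exact/measurable_EFinP/measurable_max_expR.
  - by move=> w _; rewrite lee_fin max_expR_nd.
have I0 : (0 <= \int[P]_w (max_expR l e J w)%:E)%E.
  by apply: integral_ge0 => w _; rewrite lee_fin max_expR_ge0.
have key K := max_expR_mean_le e K J0.
(* [B] lies above a real [U], so it is not [-oo]; if it is [+oo] the bound is trivial as [C] is
   positive. *)
case BE : B => [b| |]; last by have [U] := key 0%N; rewrite BE.
  2: by rewrite gt0_muley ?lte_fin// leey.
have keyb K : (\int[P]_w (max_expR l e J w)%:E <=
    (C * b * expR (q ^+ K * ln J%:R))%:E)%E.
  have [U UB Ule] := key K; apply: (le_trans Ule).
  rewrite lee_fin ler_pM2r ?expR_gt0// ler_pM2l//.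
  by rewrite BE lee_fin in UB.
move: I0 keyb; case: (\int[P]_w _)%E => [i| |]//; last first.
  by move=> _ /(_ 0%N); rewrite leye_eq.
move=> _ keyb; rewrite -EFinM lee_fin.
have /andP[q0 q1] := q01.
have cqK : q ^+ K @[K --> \oo] --> 0 by apply: cvg_expr; rewrite gtr0_norm.
have cv : C * b * expR (q ^+ K * ln J%:R) @[K --> \oo] --> C * b * expR (0 * ln J%:R).
  apply: cvgM; first exact: cvg_cst.
  apply: continuous_cvg; first exact: continuous_expR.
  by apply: cvgM; [exact: cqK|exact: cvg_cst].
rewrite mul0r expR0 mulr1 in cv; rewrite -(cvg_lim _ cv)//; apply: limr_ge; first exact: cvgP cv.
by apply: nearW => K; have := keyb K; rewrite lee_fin.
Qed.

Lemma sup_expR_mean_le (e : nat -> T) :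
  let g w := ereal_sup (range (fun J => (max_expR l e J w)%:E)) in
  measurable_fun setT g /\ (\int[P]_w g w <= C%:E * B)%E.
Proof.
move=> g.
have nd w : {homo (fun J => (max_expR l e J w)%:E) : i j / (i <= j)%N >-> (i <= j)%E}.
  by move=> i j ij; rewrite lee_fin max_expR_nd.
have gE : g = fun w => limn (fun J => (max_expR l e J w)%:E).
  by apply/funext => w; apply/esym/cvg_lim => //; exact: ereal_nondecreasing_cvgn.
have mM J : measurable_fun setT (fun w => (max_expR l e J w)%:E).
  exact/measurable_EFinP/measurable_max_expR.
split.
  apply: (@emeasurable_fun_cvg _ _ _ setT (fun J w => (max_expR l e J w)%:E)) => //.
  by move=> w _; exact: ereal_nondecreasing_cvgn.
rewrite gE (monotone_convergence P measurableT mM) => [| J w _|w _]; last 2 first.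
- by rewrite lee_fin max_expR_ge0.
- exact: nd.
apply: lime_le.
  apply: ereal_nondecreasing_is_cvgn => i j ij; apply: ge0_le_integral => //.
  - by move=> w _; rewrite lee_fin max_expR_ge0.
  - by move=> w _; exact: nd.
by apply: nearW => J; exact: max_expR_mean_rinv.
Qed.

End entropy.
End gaussian_process.

(** * Separability *)

(** Separability is applied to the whole index set and the closed interval [-c, c]; the null set
    serves all [c] at once. *)
Lemma separable_process_bound (R : realType) (d : measure_display)
  (Omega : measurableType d) (P : probability Omega R) (T : Type)
  (rho : T -> T -> R) (X : T -> Omega -> R) (t0 : T) :
  separable_process P rho X ->
  exists (e : nat -> T) (Oz : set Omega), measurable Oz /\ P Oz = 0%E /\
    forall w c, ~ Oz w -> (forall j, `|X (e j) w| <= c) -> forall t, `|X t w| <= c.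
Proof.
move=> [S [cS [dS [Oz [mO [PO sepO]]]]]].
have /countable_injP[f finj] := cS.
(* [e] inverts the injection [f] of [S] into the integers, with [t0] as value off its image. *)
have /choice[e eP] : forall n, exists t, (exists2 s, S s & f s = n) -> S t /\ f t = n.
  move=> n; have [[s Ss fs]|ns] := pselect (exists2 s, S s & f s = n); first by exists s.
  by exists t0.
exists e, Oz; split => //; split => // w c nOw ec t.
have clD : closed [set x : R | `|x| <= c].
  rewrite [X in closed X](_ : _ = (Num.norm : R -> R) @^-1` [set x : R | x <= c])//.
  by apply: closed_comp; [move=> x _; exact: norm_continuous|exact: closed_le].
have openT : rho_open rho [set: T] by move=> s _; exists 1.
have sub := sepO _ _ openT clD.
apply: contrapT => tc; apply: nOw; apply: sub; right; split => /=; last by move=> /(_ t I).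
move=> s _ Ss; have [Se fe] := eP (f s) (ex_intro2 _ _ s Ss erefl).
by rewrite -(finj _ _ _ _ fe) ?inE.
Qed.

(** * The exponential moment and tail bounds *)

Unset Implicit Arguments.

Theorem theorem1 (R : realType) (d : measure_display) (Omega : measurableType d)
  (P : probability Omega R) (T : Type) (X : T -> Omega -> R)
  (r : R -> R) :
  centered_gaussian_process P X ->
  (0 < msup P X)%E -> (msup P X < +oo)%E ->
  separable_pm (rhoX P X) ->
  separable_process P (rhoX P X) X ->
  (forall u, 1 <= u -> 0 <= r u) ->
  (forall u v, 1 <= u -> u <= v -> r u <= r v) ->
  (forall (x y a : R), 0 <= x -> 0 <= y -> 0 <= a <= 1 ->
     r (expR (a * x + (1 - a) * y)) <= a * r (expR x) + (1 - a) * r (expR y)) ->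
  (Ir r (rhoX P X) (fine (msup P X)) < +oo)%E ->
  let m := fine (msup P X) in
  let supX := fun w => ereal_sup [set (`|X t w|)%:E | t in [set: T]] in
  let bnd (theta : R) := rinv r (Ir r (rhoX P X) (theta * m) * ((theta * m)^-1)%:E)%E in
  (* (i) *)
  (forall theta lambda : R, 0 < theta < 1 -> 0 < lambda ->
     exists g : Omega -> \bar R, measurable_fun setT g /\
       (forall w, (expeR (lambda%:E * supX w) <= g w)%E) /\
       (\int[P]_w g w <=
          (2 * expR (lambda ^+ 2 * m ^+ 2 / (2 * (1 - theta) ^+ 2)))%:E * bnd theta)%E) /\
  (* (ii) *)
  (forall theta mu : R, 0 < theta < 1 -> 0 < mu ->
     exists A : set Omega, measurable A /\
       [set w | (mu%:E <= supX w)%E] `<=` A /\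
       (P A <= (2 * expR (- (mu ^+ 2 * (1 - theta) ^+ 2) / (2 * m ^+ 2)))%:E * bnd theta)%E).
Proof.
move=> gX msup0 msupy _ sepX r0 r_nd r_conv Iry m supX bnd.
(* Over an empty index set [msup] would be [-oo], against its positivity. *)
have [t0 _] : exists t : T, True.
  apply/not_existsP => nT; move: msup0; rewrite /msup.
  rewrite (_ : [set _ | t in _] = set0) ?ereal_sup0//.
  by apply/seteqP; split => // x [t _ _]; exact: (nT t).
have m0 : 0 < m := msup_gt0 msup0 msupy.
have part1 (theta lambda : R) : 0 < theta < 1 -> 0 < lambda ->
    exists g : Omega -> \bar R, measurable_fun setT g /\
      (forall w, (expeR (lambda%:E * supX w) <= g w)%E) /\
      (\int[P]_w g w <=
        (2 * expR (lambda ^+ 2 * m ^+ 2 / (2 * (1 - theta) ^+ 2)))%:E * bnd theta)%E.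
  move=> q01 l0.
  have [e [Oz [mO [PO bound]]]] := separable_process_bound t0 sepX.
  have [mg gle] := sup_expR_mean_le gX t0 msup0 msupy r0 r_nd r_conv Iry q01 l0 e.
  set g := (fun w => ereal_sup _) in mg gle.
  have g_ge w j : ((expR (lambda * `|X (e j) w|))%:E <= g w)%E.
    apply: (@le_trans _ _ (max_expR X lambda e j.+1 w)%:E).
      by rewrite lee_fin /= le_max lexx orbT.
    by apply: ereal_sup_ubound; exists j.+1.
  have g0 w : (0 <= g w)%E by apply: le_trans (g_ge w 0%N); rewrite lee_fin expR_ge0.
  (* Adding [+oo] on the null set makes the majorant valid everywhere without changing its
     integral. *)
  pose h := cst +oo%E \_ Oz : Omega -> \bar R.
  have mh : measurable_fun setT h by apply/(measurable_restrictT _ mO); exact: measurable_cst.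
  have h0 w : (0 <= h w)%E by rewrite /h patchE; case: ifP => // _; exact: leey.
  exists (fun w => g w + h w)%E; split; first exact: emeasurable_funD.
  split; last first.
    rewrite ge0_integralD// -(integral_mkcond Oz) integral_cst//.
    by rewrite [X in (+oo * X)%E](_ : _ = 0%E) ?mule0 ?adde0//.
  move=> w; have [Ow|nOw] := pselect (Oz w).
    by rewrite /h patchE mem_set// addey ?leey//; case: (g w) (g0 w).
  rewrite /h patchE memNset// adde0.
  move: (g0 w) (g_ge w); case: (g w) => [b| |]//; last by move=> _ _; exact: leey.
  move=> _ g_geb.
  (* A finite value [b] of [g] bounds |X| along [e] by ln b / lambda, and separability extends this
     to all indices. *)
  have b0 : 0 < b by rewrite -lte_fin (lt_le_trans _ (g_geb 0%N))// lte_fin expR_gt0.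
  have le_b j : `|X (e j) w| <= lambda^-1 * ln b.
    rewrite ler_pdivlMl// -ler_expR lnK ?posrE//.
    by have := g_geb j; rewrite lee_fin.
  have sup_le : (supX w <= (lambda^-1 * ln b)%:E)%E.
    by apply: ge_ereal_sup => _ [t _ <-]; rewrite lee_fin; exact: bound le_b t.
  apply: (@le_trans _ _ (expeR (lambda%:E * (lambda^-1 * ln b)%:E))).
    by rewrite lee_expeR lee_wpmul2l// lee_fin ltW.
  by rewrite -EFinM /= mulrA divff ?gt_eqF// mul1r lnK// posrE.
split=> // theta mu q01 mu0.
have /andP[q0 q1] := q01.
have q1' : 0 < 1 - theta by rewrite subr_gt0.
(* The minimiser of the exponent in Chernoff's bound. *)
pose l := mu * (1 - theta) ^+ 2 / m ^+ 2.
have l0 : 0 < l by rewrite divr_gt0 ?mulr_gt0 ?exprn_gt0.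
have [g [mg [supg gle]]] := part1 theta l q01 l0.
have g0 w : (0 <= g w)%E by apply: le_trans (supg w); exact: expeR_ge0.
(* A superlevel set of the measurable majorant contains the event, and Markov's inequality bounds
   its probability. *)
exists [set w | ((expR (l * mu))%:E <= g w)%E]; split.
  by rewrite -[X in measurable X]setTI; exact: emeasurable_fun_c_infty.
split.
  move=> w /= muw; apply: le_trans (supg w).
  have -> : (expR (l * mu))%:E = expeR (l%:E * mu%:E) by [].
  by rewrite lee_expeR lee_wpmul2l// lee_fin ltW.
have := le_integral_abse P measurableT mg (expR_gt0 (l * mu)).
rewrite setTI; under eq_integral do rewrite gee0_abs//.
under eq_set do rewrite gee0_abs//.
move=> /le_trans/(_ gle); rewrite -lee_pdivlMl ?expR_gt0// muleA -EFinM.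
have -> // : (expR (l * mu))^-1 * (2 * expR (l ^+ 2 * m ^+ 2 / (2 * (1 - theta) ^+ 2))) =
  2 * expR (- (mu ^+ 2 * (1 - theta) ^+ 2) / (2 * m ^+ 2)).
rewrite mulrCA -expRN -expRD; congr (_ * expR _).
by rewrite /l; field; rewrite !gt_eqF.
Qed.
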